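(* Let $X$ and $Y$ be Banach spaces, let $\varepsilon>0$, and let $T\in\mathcal{L}(X,Y)$ be a strong Radon-Nikodým operator. Then there exists a quasi norm attaining operator $S\in \mathrm{QNA}(X,Y)$ such that (i) $\|S-T\|<\varepsilon$; (ii) there exists $z_0\in\overline{S(B_X)}$ with $\|z_0\|=\|S\|$ such that whenever a sequence $(x_n)\subseteq B_X$ satisfies $\|Sx_n\|\to\|S\|$, there is a sequence $(\theta_n)\subseteq\mathbb{T}$ such that $S(\theta_n x_n)\to z_0$; in particular, there are $\theta_0\in\mathbb{T}$ and a subsequence $(x_{\sigma(n)})$ of $(x_n)$ such that $Sx_{\sigma(n)}\to\theta_0 z_0$.
   Context: Banach spaces are over $\mathbb{K}=\mathbb{R}$ or $\mathbb{C}$; $\mathbb{T}=\{\theta\in\mathbb{K}:|\theta|=1\}$; $B_X$ is the closed unit ball of $X$; $\mathcal{L}(X,Y)$ is the space of bounded linear operators with the operator norm. An operator $S\in\mathcal{L}(X,Y)$ is quasi norm attaining, $S\in\mathrm{QNA}(X,Y)$, if there is $u\in\overline{S(B_X)}$ (norm closure) with $\|u\|=\|S\|$. A closed convex subset $D$ of a Banach space is an RNP set if every (nonempty) subset of $D$ is dentable, where a set $A$ is dentable if for every $\delta>0$ there is $a\in A$ not belonging to the closed convex hull of $A\setminus\{b:\|b-a\|<\delta\}$. An operator $T\in\mathcal{L}(X,Y)$ is a strong Radon-Nikodým operator if $\overline{T(B_X)}$ is an RNP set. *)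

(* Defs.v *)
From HB Require Import structures.
From mathcomp Require Import all_boot all_order all_algebra.
From mathcomp Require Import all_classical all_reals all_analysis.
From mathcomp Require Import complex.

Set Implicit Arguments.
Unset Strict Implicit.
Unset Printing Implicit Defensive.

Import Order.TTheory GRing.Theory Num.Theory.
Import numFieldNormedType.Exports.

Local Open Scope classical_set_scope.
Local Open Scope ring_scope.

(* The scalar field is the real line R or the complex field R[i].  Norms of a
   normedModType K take their values in K.  On R[i] the order is the partial
   one in which 0 <= z says that z is a nonnegative real, so a bound
   0 < e, a supremum of norms or a coefficient in {i01 K} is a real number
   in both cases. *)
Definition real_or_complex (R : realType) (K : numFieldType) : Prop :=
  K = (R : numFieldType) \/ K = (R[i] : numFieldType).

Definition closed_unit_ball (K : numFieldType) (X : normedModType K) : set X :=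
  [set x | `|x| <= 1].
Arguments closed_unit_ball {K} X.

Definition bounded_operator (K : numFieldType) (X Y : normedModType K)
    (T : {linear X -> Y}) : Prop :=
  [bounded T x | x in closed_unit_ball X].

Definition opnorm (K : numFieldType) (X Y : normedModType K)
    (f : X -> Y) : K :=
  supremum 0 [set `|f x| | x in closed_unit_ball X].

Definition closed_ball_image (K : numFieldType) (X Y : normedModType K)
    (f : X -> Y) : set Y :=
  closure (f @` closed_unit_ball X).

Definition QNA (K : numFieldType) (X Y : normedModType K)
    (S : {linear X -> Y}) : Prop :=
  bounded_operator S /\
  exists2 u, closed_ball_image S u & `|u| = opnorm S.

Definition closed_convex_hull (K : numFieldType) (Y : normedModType K)
    (A : set Y) : set Y :=
  smallest [set C : set Y | closed C /\ convex_set C] A.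

Definition dentable (K : numFieldType) (Y : normedModType K)
    (A : set Y) : Prop :=
  forall delta : K, 0 < delta ->
    exists2 a, A a &
      ~ closed_convex_hull (A `\` [set b | `|b - a| < delta]) a.

Definition RNP_set (K : numFieldType) (Y : normedModType K)
    (D : set Y) : Prop :=
  [/\ closed D, convex_set D &
      forall A : set Y, A `<=` D -> A !=set0 -> dentable A].

Definition strong_Radon_Nikodym (K : numFieldType) (X Y : normedModType K)
    (T : {linear X -> Y}) : Prop :=
  RNP_set (closed_ball_image T).

(* Main.v *)
(** The idea is Stegall's variational principle on D = closure (T B_X): if D is
a bounded RNP set, there is a small real functional w such that norm + w
attains its maximum over D strongly, at some y0.  With psi the K-linear
functional of real part w and u = y0 / |y0| (0 if y0 = 0), the rank-one perturbation
S x = T x + psi (T x) u satisfies |S x| <= |T x| + |psi (T x)|, and, D being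
stable under unimodular scalars, the right-hand side has maximum
|y0| + psi y0 = |z0| for z0 = y0 + psi y0 u.  If |S x_n| tends to this maximum,
then T (theta_n x_n) is a maximizing sequence of norm + w as soon as theta_n
makes psi (T (theta_n x_n)) nonnegative, hence it tends to y0.

For the variational principle, replace the norm by its concave envelope F.  The
set A of exact maximizers of F + w, w small, is nonempty and approximates almost
maximizers by Ekeland's principle and a Hahn-Banach sandwich (Brondsted and
Rockafellar).  A small slice of A, which exists by dentability, gives by
monotonicity a functional with a small set of almost maximizers; iterating
produces w. *)

Require Import Defs.
From HB Require Import structures.
From mathcomp Require Import all_boot all_order all_algebra.
From mathcomp Require Import all_classical all_reals all_analysis.
From mathcomp Require Import complex ring lra.

Set Implicit Arguments.
Unset Strict Implicit.
Unset Printing Implicit Defensive.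

Import Order.TTheory GRing.Theory Num.Theory.
Import numFieldNormedType.Exports.

Local Open Scope classical_set_scope.
Local Open Scope ring_scope.

(** * The Hahn-Banach theorem for convex functions *)

Section InfImage.
Context {R : realType} {I : Type}.
Implicit Types (P : set I) (F : I -> R).

Lemma inf_image_le P F c i :
  (forall j, P j -> c <= F j) -> P i -> inf (F @` P) <= F i.
Proof.
move=> cF Pi; apply: ge_inf; last by exists i.
by exists c => _ [j Pj <-]; exact: cF.
Qed.

Lemma le_inf_image P F c :
  P !=set0 -> (forall j, P j -> c <= F j) -> c <= inf (F @` P).
Proof.
move=> [i Pi] cF; apply: lb_le_inf; first by exists (F i), i.
by move=> _ [j Pj <-]; exact: cF.
Qed.

Lemma le_mul_inf_image P F t b x : P !=set0 -> 0 <= t ->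
  (forall i, P i -> x <= t * F i + b) -> x <= t * inf (F @` P) + b.
Proof.
move=> P0; rewrite le_eqVlt => /predU1P[<- xF|t0 xF].
  by case: P0 => i Pi; rewrite mul0r -(mul0r (F i)) xF.
rewrite -lerBlDr mulrC -ler_pdivrMr //; apply: le_inf_image => // i Pi.
by rewrite ler_pdivrMr // lerBlDr mulrC xF.
Qed.

(** The two indices are freed one after the other. With [F] and [G] the values at two points, this
    is how an infimum of functions is shown convex. *)
Lemma le_conv_inf_image P F G t x : P !=set0 -> 0 <= t -> t <= 1 ->
  (forall i j, P i -> P j -> x <= t * F i + (1 - t) * G j) ->
  x <= t * inf (F @` P) + (1 - t) * inf (G @` P).
Proof.
move=> P0 t0 t1 xFG; apply: le_mul_inf_image => // i Pi.
rewrite (addrC (t * F i)); apply: le_mul_inf_image => // [|j Pj].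
  by rewrite subr_ge0.
by rewrite (addrC _ (t * F i)) xFG.
Qed.

End InfImage.

Section HahnBanach.
Context {R : realType} {V : lmodType R}.

Definition is_convex (D : set V) := forall x y (t : R), D x -> D y ->
  0 <= t -> t <= 1 -> D (t *: x + (1 - t) *: y).

Definition convex_on (D : set V) (c : V -> R) := forall x y (t : R),
  D x -> D y -> 0 <= t -> t <= 1 ->
  c (t *: x + (1 - t) *: y) <= t * c x + (1 - t) * c y.

Lemma is_scalarD (g : V -> R) : scalar g -> {morph g : x y / x + y}.
Proof. by move=> gl x y; have := gl 1 x y; rewrite scale1r mul1r. Qed.

Lemma is_scalar0 (g : V -> R) : scalar g -> g 0 = 0.
Proof. by move=> gl; have := gl 1 0 0; rewrite scale1r addr0; lra. Qed.

Lemma is_scalarZ (g : V -> R) : scalar g -> forall a x, g (a *: x) = a * g x.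
Proof. by move=> gl a x; rewrite -[a *: x]addr0 gl (is_scalar0 gl) addr0. Qed.

Lemma is_scalarN (g : V -> R) : scalar g -> {morph g : x / - x}.
Proof. by move=> gl x; rewrite -scaleN1r (is_scalarZ gl) mulN1r. Qed.

Lemma is_scalarB (g : V -> R) : scalar g -> {morph g : x y / x - y}.
Proof. by move=> gl x y; rewrite (is_scalarD gl) (is_scalarN gl). Qed.

Lemma convexT_mid (q : V -> R) : convex_on setT q ->
  forall x y, 2 * q (2^-1 *: (x + y)) <= q x + q y.
Proof.
move=> qc x y; have := qc x y 2^-1 I I ltac:(lra) ltac:(lra).
have -> : 1 - 2^-1 = 2^-1 :> R by lra.
by rewrite -scalerDr; lra.
Qed.

(** The weights [t / (s + t)] and [s / (s + t)] combine [s *: v] and [- t *: v] to 0, where [q] is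
    nonnegative. Thus some slope separates the difference quotients to the left of 0 from those to
    the right. *)
Lemma convex_ray (q : V -> R) (v : V) (s t : R) : convex_on setT q -> 0 <= q 0 ->
  0 < s -> 0 < t -> - q (- t *: v) / t <= q (s *: v) / s.
Proof.
move=> qc q0 s0 t0; have st0 : 0 < s + t by lra.
have r0 : 0 <= t / (s + t) by rewrite divr_ge0 ?ltW.
have r1 : t / (s + t) <= 1 by rewrite ler_pdivrMr //; lra.
have := qc (s *: v) (- t *: v) _ I I r0 r1.
have -> : 1 - t / (s + t) = s / (s + t) by field; lra.
rewrite !scalerA -scalerDl (_ : _ + _ = 0); last by field; lra.
rewrite scale0r => /(le_trans q0).
have -> : t / (s + t) * q (s *: v) + s / (s + t) * q (- t *: v) =
  (s * t / (s + t)) * (q (s *: v) / s - - q (- t *: v) / t).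
  by field; rewrite !gt_eqF.
have k0 : 0 < s * t / (s + t) by rewrite divr_gt0 // mulr_gt0.
by rewrite (pmulr_rge0 _ k0) subr_ge0.
Qed.

(* A pointwise minimal convex function that is nonnegative at 0 coincides, for
   every direction v and a slope c supporting it along v, with
   w |-> inf_t (q (w + t v) - t c); hence it is affine along v. *)
Lemma minimal_convex_scalar (q : V -> R) : convex_on setT q -> 0 <= q 0 ->
  (forall r : V -> R, convex_on setT r -> 0 <= r 0 -> (forall v, r v <= q v) ->
     r = q) ->
  scalar q.
Proof.
move=> qc q0 qmin.
have q00 : q 0 = 0.
  (* Minimality is applied to [q] lowered by the constant [q 0]. *)
  have e : (fun v => q v - q 0) = q.
    by apply: qmin => [x y t _ _ t0 t1| |v]; rewrite ?subrr ?gerBl //;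
      have := qc x y t I I t0 t1; lra.
  by have := congr1 (@^~ 0) e; rewrite subrr => <-.
have slope v : exists c, forall w (t : R), q (w + t *: v) = q w + t * c.
  pose A := [set t : R | 0 < t].
  (* The right derivative of [q] at 0 along [v]; the left difference quotients bound the infimum
     below. *)
  pose c := inf ((fun t => q (t *: v) / t) @` A).
  have A0 : A !=set0 by exists 1; exact: ltr01.
  have cP t : t * c <= q (t *: v).
    have [t0|t0|->] := ltgtP t 0; last by rewrite mul0r scale0r.
      have nt0 : 0 < - t by rewrite oppr_gt0.
      have : - q (- - t *: v) / - t <= c.
        by apply: le_inf_image => // s s0; exact: convex_ray.
      by rewrite opprK ler_pdivrMr // mulrN mulrC; lra.
    rewrite mulrC -ler_pdivlMr //.
    by apply: (inf_image_le (c := - q (- 1 *: v) / 1)) => // s s0; exact: convex_ray.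
  pose r w := inf ((fun t => q (w + t *: v) - t * c) @` setT).
  have T0 : [set: R] !=set0 by exists 0.
  (* [- w] and [w + t *: v] have midpoint [(2^-1 * t) *: v], where [cP] applies; this makes the
     infimum [r w] finite. *)
  have lb w t : - q (- w) <= q (w + t *: v) - t * c.
    have := convexT_mid qc (w + t *: v) (- w).
    rewrite addrAC subrr add0r scalerA; have := cP (2^-1 * t); lra.
  have rle w t : r w <= q (w + t *: v) - t * c.
    by apply: inf_image_le => // s _; exact: lb.
  have rq : r = q.
    apply: qmin => [x y t _ _ t0 t1| |w].
    - rewrite /r; apply: le_conv_inf_image => // i j _ _.
      apply: le_trans (rle _ (t * i + (1 - t) * j)) _.
      have -> : t *: x + (1 - t) *: y + (t * i + (1 - t) * j) *: v =
          t *: (x + i *: v) + (1 - t) *: (y + j *: v).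
        by rewrite (scalerDl v) !scalerDr !scalerA addrACA.
      by have := qc (x + i *: v) (y + j *: v) t I I t0 t1; lra.
    - by apply: le_inf_image => // t _; rewrite add0r subr_ge0.
    - by apply: le_trans (rle w 0) _; rewrite scale0r addr0 mul0r subr0.
  (* With [r = q], the shift by [t] from [w] and the shift by [- t] back from [w + t *: v] give the
     two inequalities. *)
  exists c => w t; apply/eqP; rewrite eq_le; apply/andP; split.
    have := rle (w + t *: v) (- t).
    by rewrite rq -addrA -scalerDl subrr scale0r addr0; lra.
  by have := rle w t; rewrite rq; lra.
move=> a u v; have [c cP] := slope u; rewrite (addrC (a *: u)) cP.
by have := cP 0 1; rewrite add0r scale1r q00 add0r mul1r => ->; rewrite addrC.
Qed.

(** Zorn's lemma yields a minimal convex function below [p] that is nonnegative at 0, and minimal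
    ones are linear. *)
Theorem hahn_banach_convex (p : V -> R) : convex_on setT p -> 0 <= p 0 ->
  exists2 g, scalar g & forall v, g v <= p v.
Proof.
move=> pc p0.
pose Q (q : V -> R) := [/\ convex_on setT q, 0 <= q 0 & forall v, q v <= p v].
have QP : Q p by split.
(* The order is reversed: a maximal element for [ge] is a pointwise minimal function. *)
pose ge (q1 q2 : {q | Q q}) := `[< forall v, sval q2 v <= sval q1 v >].
have geP q1 q2 : ge q1 q2 <-> forall v, sval q2 v <= sval q1 v.
  by split => [/asboolP|?]; last exact/asboolP.
have lb (q : {q | Q q}) v : - p (- v) <= sval q v.
  case: q => q [qc q0 qp] /=; have := convexT_mid qc v (- v).
  by rewrite subrr scaler0; have := qp (- v); lra.
have [|r s t|A totA|[q [qc q0 qp]] qmax] := @ZL_preorder _ (exist Q p QP) ge.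
- by move=> t; apply/geP.
- by move=> /geP rs /geP st; apply/geP => v; exact: le_trans (st v) (rs v).
- have [[a Aa]|A0] := pselect (A !=set0); last first.
    by exists (exist Q p QP) => s As; exfalso; apply: A0; exists s.
  pose m v := inf ((fun q : {q | Q q} => sval q v) @` A).
  have mle s v : A s -> m v <= sval s v.
    by move=> As; apply: inf_image_le => // j _; exact: lb.
  have A0 : A !=set0 by exists a.
  have mQ : Q m.
    split => [x y t _ _ t0 t1| |v].
    - rewrite /m; apply: le_conv_inf_image => // i j Ai Aj.
      have t1' : 0 <= 1 - t by rewrite subr_ge0.
      (* Two members of a chain are comparable, and the smaller one serves at both points. *)
      have [/geP ij|/geP ji] := totA _ _ Ai Aj.
        apply: le_trans (mle j _ Aj) _; have [jc _ _] := svalP j.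
        by have := jc x y t I I t0 t1; have := ler_wpM2l t0 (ij x); lra.
      apply: le_trans (mle i _ Ai) _; have [ic _ _] := svalP i.
      by have := ic x y t I I t0 t1; have := ler_wpM2l t1' (ji y); lra.
    - by apply: le_inf_image => // -[s []].
    - by apply: le_trans (mle a v Aa) _; case: (svalP a).
  by exists (exist Q m mQ) => s As; apply/geP => v /=; exact: mle.
exists q => //; apply: minimal_convex_scalar => // r rc r0 rq.
have rQ : Q r by split => // v; exact: le_trans (rq v) (qp v).
have /geP qr : ge (exist Q r rQ) (exist Q q (And3 qc q0 qp)).
  by apply: qmax; apply/geP.
by apply/funext => v; apply/eqP; rewrite eq_le rq (qr v).
Qed.

End HahnBanach.

(** * Bishop-Phelps type support points *)

Section SupportPoints.
Context {R : realType} {V : lmodType R}.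
Definition is_seminorm (N : V -> R) :=
  (forall x y, N (x + y) <= N x + N y) /\
  (forall (a : R) x, N (a *: x) = `|a| * N x).

Context (N : V -> R) (Nnorm : is_seminorm N).
Implicit Types (x y z : V) (D : set V) (f G w : V -> R).

Definition dominated (r : R) w := forall v, `|w v| <= r * N v.

Definition usc_on D G := forall l, D l -> forall e, 0 < e ->
  exists2 d, 0 < d & forall y, D y -> N (y - l) < d -> G y <= G l + e.

Definition converges_to (u : nat -> V) l := forall e, 0 < e ->
  exists n0, forall n, (n0 <= n)%N -> N (u n - l) < e.

Definition complete_on D := forall u : nat -> V, (forall n, D (u n)) ->
  (forall e, 0 < e ->
     exists n0, forall n, (n0 <= n)%N -> N (u n - u n0) <= e) ->
  exists2 l, D l & converges_to u l.

Lemma norm_add x y : N (x + y) <= N x + N y. Proof. exact: Nnorm.1. Qed.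

Lemma norm_scale (a : R) x : N (a *: x) = `|a| * N x.
Proof. exact: Nnorm.2. Qed.

Lemma norm0 : N 0 = 0.
Proof. by rewrite -(scale0r 0) norm_scale normr0 mul0r. Qed.

Lemma norm_opp x : N (- x) = N x.
Proof. by rewrite -scaleN1r norm_scale normrN1 mul1r. Qed.

Lemma norm_distC x y : N (x - y) = N (y - x).
Proof. by rewrite -opprB norm_opp. Qed.

Lemma norm_dist x y z : N (x - z) <= N (x - y) + N (y - z).
Proof. by rewrite -{1}(subrK y x) -addrA norm_add. Qed.

Lemma norm_ge0 x : 0 <= N x.
Proof. by have := norm_dist 0 x 0; rewrite !subr0 sub0r norm_opp norm0; lra. Qed.

Lemma conv_subr (x y i j : V) (t : R) :
  t *: (x - i) + (1 - t) *: (y - j) =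
  t *: x + (1 - t) *: y - (t *: i + (1 - t) *: j).
Proof. by rewrite !scalerBr addrACA -opprD. Qed.

Lemma conv_same (a : V) (t : R) : t *: a + (1 - t) *: a = a.
Proof. by rewrite -scalerDl addrC subrK scale1r. Qed.

Lemma norm_conv (x y : V) (t : R) : 0 <= t -> t <= 1 ->
  N (t *: x + (1 - t) *: y) <= t * N x + (1 - t) * N y.
Proof.
move=> t0 t1; apply: le_trans (norm_add _ _) _.
by rewrite !norm_scale !ger0_norm ?subr_ge0.
Qed.

Lemma dominated0 r : 0 <= r -> dominated r (fun=> 0).
Proof. by move=> r0 v; rewrite normr0 mulr_ge0 // norm_ge0. Qed.

Lemma dominatedD r s (u w : V -> R) :
  dominated r u -> dominated s w -> dominated (r + s) (fun v => u v + w v).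
Proof.
move=> ur ws v; apply: le_trans (ler_normD _ _) _.
by rewrite mulrDl lerD.
Qed.

Lemma dominatedZ r (t : R) w : dominated r w ->
  dominated (`|t| * r) (fun v => t * w v).
Proof. by move=> wr v; rewrite normrM -mulrA ler_wpM2l. Qed.

Lemma dominated_le r s w : r <= s -> dominated r w -> dominated s w.
Proof.
by move=> rs wr v; apply: le_trans (wr v) _; rewrite ler_wpM2r // norm_ge0.
Qed.

Lemma scalar_add (u w : V -> R) : scalar u -> scalar w -> scalar (fun v => u v + w v).
Proof. by move=> ul wl a x y; rewrite ul wl mulrDr addrACA. Qed.

Lemma scalar_mull (u : V -> R) (t : R) : scalar u -> scalar (fun v => t * u v).
Proof. by move=> ul a x y; rewrite ul mulrDr mulrCA. Qed.

Lemma scalar_cst0 : scalar (fun _ : V => 0 : R).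
Proof. by move=> a x y; rewrite mulr0 addr0. Qed.

Lemma scalar_dominated w r : 0 <= r -> scalar w ->
  (exists K, forall v, w v <= r * N v + K) -> dominated r w.
Proof.
move=> r0 wl [K wK].
have wr v : w v <= r * N v.
  rewrite leNgt; apply/negP => lt.
  have d0 : 0 < w v - r * N v by rewrite subr_gt0.
  (* At [t *: v] the excess of [w] over [r * N] is [|K| + 1], more than the constant [K] allows. *)
  pose t := (`|K| + 1) / (w v - r * N v).
  have t0 : 0 < t by rewrite divr_gt0 // ltr_wpDl.
  have := wK (t *: v); rewrite (is_scalarZ wl) norm_scale (gtr0_norm t0).
  have : t * (w v - r * N v) = `|K| + 1 by rewrite /t divfK // gt_eqF.
  have := ler_norm K; lra.
move=> v; rewrite ler_norml wr andbT lerNl -(is_scalarN wl).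
by apply: le_trans (wr _) _; rewrite norm_opp.
Qed.

(** Hahn-Banach is applied to the infimal convolution [q] of [r * N] with [c], translated by [a];
    the hypothesis says [0 <= q 0]. The choice [v = y - a] gives [w (y - a) <= c y], and a fixed [y]
    shows that [w] grows at most like [r * N]. *)
Lemma lipschitz_sandwich D (c : V -> R) (a : V) (r : R) :
  is_convex D -> convex_on D c -> 0 <= r ->
  (forall y, D y -> 0 <= r * N (y - a) + c y) ->
  exists w, [/\ scalar w, dominated r w & forall y, D y -> w (y - a) <= c y].
Proof.
move=> Dc cc r0 pos.
have [D0|D0] := pselect (D !=set0); last first.
  exists (fun=> 0); split; [exact: scalar_cst0|exact: dominated0|].
  by move=> y Dy; case: D0; exists y.
pose F v y := r * N (v - (y - a)) + c y.
have lbF v y : D y -> - (r * N v) <= F v y.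
  move=> Dy; have := pos y Dy; rewrite /F.
  have := norm_dist (y - a) v 0; rewrite !subr0 (norm_distC _ v) => h.
  by have := ler_wpM2l r0 h; lra.
pose q v := inf (F v @` D).
have qle v y : D y -> q v <= F v y.
  by move=> Dy; apply: inf_image_le => // j; exact: lbF.
have [|/=|w wl wq] := @hahn_banach_convex _ V q.
- move=> x y t _ _ t0 t1; apply: le_conv_inf_image => // i j Di Dj.
  apply: le_trans (qle _ _ (Dc i j t Di Dj t0 t1)) _; rewrite /F.
  have -> : t *: x + (1 - t) *: y - (t *: i + (1 - t) *: j - a) =
      t *: (x - (i - a)) + (1 - t) *: (y - (j - a)).
    by rewrite conv_subr conv_subr conv_same.
  have := cc i j t Di Dj t0 t1.
  by have := ler_wpM2l r0 (norm_conv (x - (i - a)) (y - (j - a)) t0 t1); lra.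
- by apply: le_inf_image => // y Dy; rewrite /F sub0r norm_opp; exact: pos.
have wF v y : D y -> w v <= F v y by move=> Dy; exact: le_trans (wq v) (qle v y Dy).
exists w; split => // [|y Dy]; last first.
  by have := wF (y - a) y Dy; rewrite /F subrr norm0 mulr0 add0r.
apply: scalar_dominated => //; case: D0 => y Dy.
exists (r * N (y - a) + c y) => v; apply: le_trans (wF v y Dy) _.
rewrite /F addrA lerD2r -mulrDr ler_wpM2l //.
by apply: le_trans (norm_add _ _) _; rewrite norm_opp.
Qed.

Lemma ltr_invS_exists (e : R) : 0 < e ->
  exists n0, forall n, (n0 <= n)%N -> n.+1%:R^-1 < e :> R.
Proof.
move=> e0; have [n0 _ nP] := near_infty_natSinv_lt (PosNum e0).
by exists n0 => n; exact: nP.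
Qed.

(** [S y] collects the points that improve on [y] by at least [r] times their distance, a transitive
    relation. Each [x n.+1] nearly maximizes [G] on [S (x n)]; the tails then have small diameter,
    and nothing lies strictly above the limit. *)
Lemma ekeland D G (b : V) (r : R) : complete_on D -> usc_on D G ->
  (exists M, forall y, D y -> G y <= M) -> 0 < r -> D b ->
  exists b', [/\ D b', G b + r * N (b' - b) <= G b' &
    forall y, D y -> G y <= G b' + r * N (y - b')].
Proof.
move=> Dcomp Gusc [M GM] r0 Db.
pose S y x := D x /\ G y + r * N (x - y) <= G x.
have Srefl y : D y -> S y y by move=> Dy; split; rewrite // subrr norm0 mulr0 addr0.
have Strans x y z : S x y -> S y z -> S x z.
  move=> [Dy xy] [Dz yz]; split => //.
  by have := ler_wpM2l (ltW r0) (norm_dist z y x); lra.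
have next (ny : nat * V) : exists x, D ny.2 ->
    S ny.2 x /\ forall x', S ny.2 x' -> G x' <= G x + ny.1.+1%:R^-1.
  case: ny => n y /=; have [Dy|nDy] := pselect (D y); last by exists y.
  have hs : has_sup (G @` S y).
    split; first by exists (G y), y => //; exact: Srefl.
    by exists M => _ [x [Dx _] <-]; exact: GM.
  have n0 : (0 : R) < n.+1%:R^-1 by rewrite invr_gt0.
  move: (n.+1%:R^-1) n0 => e n0.
  have [_ [x Sx <-] lt] := sup_adherent n0 hs.
  exists x => _; split => // x' Sx'.
  have : G x' <= sup (G @` S y) by apply: ub_le_sup; [case: hs|exists x'].
  lra.
have [F FP] := choice next.
pose x := nat_rect (fun=> V) b (fun n y => F (n, y)).
have Dx n : D (x n) by elim: n => //= n IH; have [[]] := FP (n, x n) IH.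
have xS n m : (n <= m)%N -> S (x n) (x m).
  elim: m => [|m IH]; first by rewrite leqn0 => /eqP ->; exact: Srefl.
  rewrite leq_eqVlt => /predU1P[-> //|]; first exact: Srefl.
  rewrite ltnS => /IH nm; apply: Strans nm _.
  by have [] := FP (m, x m) (Dx m).
have xmax n y : S (x n) y -> G y <= G (x n.+1) + n.+1%:R^-1.
  by have [_] := FP (n, x n) (Dx n); apply.
have [|b' Db' xb'] := Dcomp x Dx.
  move=> e e0; have [n nP] := ltr_invS_exists (mulr_gt0 r0 e0).
  exists n.+1 => m nm; have [_ h] := xS _ _ nm.
  have h' := xmax n _ (xS _ _ (ltnW nm)).
  have h'' := nP n (leqnn n).
  by rewrite -(ler_pM2l r0); move: (n.+1%:R^-1) h' h'' => s h' h''; lra.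
have Sb' n : S (x n) b'.
  split => //; apply/ler_addgt0Pl => e e0.
  (* Upper semicontinuity costs [e / (1 + r)] and the distance term [r] times as much, [e] in
     total. *)
  have k0 : 0 < e / (1 + r) by rewrite divr_gt0 // addr_gt0.
  have [d d0 Gd] := Gusc b' Db' _ k0.
  have m0 : 0 < Num.min d (e / (1 + r)) by rewrite lt_min d0.
  have [n0 n0P] := xb' _ m0.
  have := n0P (maxn n n0) (leq_maxr _ _); set m := maxn n n0.
  rewrite lt_min => /andP[md me].
  have [_ h] := xS n m (leq_maxl _ _).
  have h1 := Gd _ (Dx m) md.
  have h2 := norm_dist b' (x m) (x n); rewrite (norm_distC b' (x m)) in h2.
  have h3 : r * N (b' - x n) <= r * (e / (1 + r) + N (x m - x n)).
    by rewrite ler_pM2l //; lra.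
  have h4 : e / (1 + r) + r * (e / (1 + r)) = e by field; lra.
  lra.
exists b'; split => //; first by case: (Sb' 0%N).
move=> y Dy; rewrite leNgt; apply/negP => lt.
have Sy : S b' y by split => //; exact: ltW.
(* [y] lies in every [S (x n)], so [G y] exceeds [G (x n.+1)], hence [G b'], by at most
   [n.+1%:R^-1]. *)
have h : G y <= G b'.
  apply/ler_addgt0Pl => e e0; have [n nP] := ltr_invS_exists e0.
  have := xmax n y (Strans _ _ _ (Sb' n) Sy).
  have [_] := Sb' n.+1; have := mulr_ge0 (ltW r0) (norm_ge0 (b' - x n.+1)).
  by have := nP n (leqnn n); move: (n.+1%:R^-1) => s; lra.
by have := mulr_ge0 (ltW r0) (norm_ge0 (y - b')); lra.
Qed.

(** At Ekeland's point [b'] the function [G] lies below a cone of slope [r]; as [G] is concave, the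
    sandwich lemma replaces the cone by a linear functional. *)
Lemma supported_point_near D G (b : V) (r : R) :
  is_convex D -> complete_on D ->
  convex_on D (fun y => - G y) -> usc_on D G ->
  (exists M, forall y, D y -> G y <= M) -> 0 < r -> D b ->
  exists b' g, [/\ D b', G b + r * N (b' - b) <= G b', scalar g, dominated r g &
    forall y, D y -> G y + g y <= G b' + g b'].
Proof.
move=> Dc Dcomp Gc Gusc Gb r0 Db.
have [b' [Db' bb' b'max]] := ekeland Dcomp Gusc Gb r0 Db.
have [||g [gl gr gmax]] :=
    @lipschitz_sandwich D (fun y => G b' - G y) b' r Dc _ (ltW r0).
- by move=> x y t Dx Dy t0 t1; have := Gc x y t Dx Dy t0 t1; lra.
- by move=> y /b'max; lra.
by exists b', g; split => // y /gmax; rewrite (is_scalarB gl); lra.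
Qed.

End SupportPoints.

(** * Stegall's variational principle *)

Section Stegall.
Context {R : realType} {V : lmodType R}.
Context (N : V -> R) (Nnorm : is_seminorm N).
Implicit Types (x y z : V) (D : set V) (f G w : V -> R).
Local Notation dominated := (dominated N).
Local Notation usc_on := (usc_on N).
Local Notation complete_on := (complete_on N).
Local Notation converges_to := (converges_to N).

Lemma usc_on_add_dominated D G w (r : R) : usc_on D G -> scalar w ->
  dominated r w -> usc_on D (fun y => G y + w y).
Proof.
move=> Gusc wl wr l Dl e e0; have e20 : 0 < e / 2 by lra.
have [d d0 dP] := Gusc l Dl _ e20.
have k0 : 0 < e / 2 / (`|r| + 1) by rewrite divr_gt0 // ltr_wpDl.
exists (Num.min d (e / 2 / (`|r| + 1))); first by rewrite lt_min d0.
move=> y Dy; rewrite lt_min => /andP[yd ye].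
have h1 := dP y Dy yd.
have h2 : w y - w l <= (`|r| + 1) * N (y - l).
  rewrite -(is_scalarB wl); apply: le_trans (ler_norm _) _.
  apply: le_trans (wr _) _; rewrite ler_wpM2r ?(norm_ge0 Nnorm) //.
  by have := ler_norm r; lra.
have : (`|r| + 1) * N (y - l) <= e / 2.
  by rewrite mulrC -ler_pdivlMr ?ltr_wpDl // ltW.
lra.
Qed.

Lemma convex_on_oppD D G w : convex_on D (fun y => - G y) -> scalar w ->
  convex_on D (fun y => - (G y + w y)).
Proof.
move=> Gc wl x y t Dx Dy t0 t1; have := Gc x y t Dx Dy t0 t1.
by rewrite (is_scalarD wl) !(is_scalarZ wl); lra.
Qed.

(** [F] is the infimum of the affine majorants [i.2 - i.1 y] with dominated linear part, hence
    concave and upper semicontinuous. A bound [c] for [f + w] is itself such a majorant [(w, c)], so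
    [f + w] and [F + w] have the same upper bounds on [D]. *)
Lemma concave_envelope D f : (exists B, forall y, D y -> f y <= B) ->
  exists F, [/\ convex_on D (fun y => - F y), usc_on D F,
    forall y, D y -> f y <= F y &
    forall w r c, scalar w -> dominated r w ->
      (forall y, D y -> f y + w y <= c) -> forall y, D y -> F y + w y <= c].
Proof.
move=> [B fB].
pose P (i : (V -> R) * R) := [/\ scalar i.1, exists r, dominated r i.1 &
  forall y, D y -> f y + i.1 y <= i.2].
pose A y (i : (V -> R) * R) := i.2 - i.1 y.
pose F y := inf (A y @` P).
have P0 : P !=set0.
  exists (fun=> 0, B); split; first exact: scalar_cst0.
    by exists 0; exact: (dominated0 Nnorm).
  by move=> y /fB /=; rewrite addr0.
have lb y i : D y -> P i -> f y <= A y i.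
  by move=> Dy [_ _ /(_ y Dy)]; rewrite /A; lra.
have Fle y i : D y -> P i -> F y <= A y i.
  by move=> Dy Pi; apply: inf_image_le => // j; exact: lb.
exists F; split.
- move=> x y t Dx Dy t0 t1.
  have : t * F x + (1 - t) * F y <= F (t *: x + (1 - t) *: y).
    apply: le_inf_image => // i Pi.
    have t1' : 0 <= 1 - t by rewrite subr_ge0.
    have := ler_wpM2l t0 (Fle x i Dx Pi).
    have := ler_wpM2l t1' (Fle y i Dy Pi).
    case: Pi => il _ _; rewrite /A (is_scalarD il) !(is_scalarZ il).
    lra.
  lra.
- move=> l Dl e e0.
  have hi : has_inf (A l @` P).
    case: P0 => i Pi; split; first by exists (A l i), i.
    by exists (f l) => _ [j Pj <-]; exact: lb.
  have e20 : 0 < e / 2 by lra.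
  have [_ [i Pi <-] lt] := inf_adherent e20 hi.
  have [il [r ir] _] := Pi.
  have cst_usc : usc_on D (fun=> i.2).
    by move=> l' _ e' e0'; exists 1 => // y _ _; lra.
  have nl : scalar (fun v => -1 * i.1 v) by exact: scalar_mull.
  have [d d0 dP] :=
    usc_on_add_dominated cst_usc nl (dominatedZ (-1) ir) Dl e20.
  exists d => // y Dy yd; have := dP y Dy yd; have := Fle y i Dy Pi.
  by move: lt; rewrite /F /A; lra.
- by move=> y Dy; apply: le_inf_image => // i Pi; exact: lb.
- move=> w r c wl wr wc y Dy.
  have Pw : P (w, c) by split => //; exists r.
  by have := Fle y _ Dy Pw; rewrite /A /=; lra.
Qed.

(** Dentability by slices: the points of [A] where [w] exceeds [w a - k] lie within [d] of [a]. *)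
Definition slice_dentable D := forall A, A `<=` D -> A !=set0 ->
  forall d, 0 < d -> exists a w C k, [/\ A a, scalar w, dominated C w, 0 < k &
    forall b, A b -> d <= N (b - a) -> w b <= w a - k].

(* A is the set of exact maximizers of F + u, with F the concave envelope of f
   and u small.  If s slices A near a0, a maximizer for u0, then by monotonicity
   the maximizers for every functional close to u0 + t s lie in that slice; near
   each almost maximizer of f + u0 + t s there is such an exact maximizer. *)
Lemma small_slice_perturbation D f (M d e : R) :
  is_convex D -> complete_on D -> slice_dentable D -> D !=set0 ->
  (forall y, D y -> N y <= M) -> (exists B, forall y, D y -> f y <= B) ->
  0 < d -> 0 < e ->
  exists w a h, [/\ scalar w, dominated d w, 0 < h &
    forall b, D b -> (forall y, D y -> f y + w y <= f b + w b + h) ->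
      N (b - a) <= e].
Proof.
move=> Dc Dcomp Dd [b0 Db0] DM [B fB] d0 e0.
have [F [Fc Fusc fF FP]] := concave_envelope (ex_intro _ B fB).
have M0 : 0 <= M by apply: le_trans (norm_ge0 Nnorm b0) (DM b0 Db0).
have Fbd w (r : R) : scalar w -> dominated r w ->
    exists C, forall y, D y -> F y + w y <= C.
  move=> wl wr; exists (B + `|r| * M); apply: (FP w r) => // y Dy.
  apply: lerD; first exact: fB.
  apply: le_trans (ler_norm _) _; apply: le_trans (wr y) _.
  apply: le_trans (ler_wpM2r (norm_ge0 Nnorm y) (ler_norm r)) _.
  by rewrite ler_wpM2l // DM.
have near_max w (r r' : R) b : scalar w -> dominated r w -> 0 < r' -> D b ->
    exists b' g, [/\ D b', F b + w b + r' * N (b' - b) <= F b' + w b',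
      scalar g, dominated r' g &
      forall y, D y -> F y + w y + g y <= F b' + w b' + g b'].
  move=> wl wr r'0 Db.
  exact: (supported_point_near Nnorm Dc Dcomp (convex_on_oppD Fc wl)
    (usc_on_add_dominated Fusc wl wr) (Fbd w r wl wr) r'0 Db).
pose A := [set a | D a /\ exists w r, [/\ scalar w, r < d, dominated r w &
  forall y, D y -> F y + w y <= F a + w a]].
have A0 : A !=set0.
  have d20 : 0 < d / 2 by lra.
  have [b' [g [Db' _ gl gd gmax]]] :=
    near_max _ 0 _ b0 (@scalar_cst0 _ _) (dominated0 Nnorm (lexx 0)) d20 Db0.
  exists b'; split => //; exists g, (d / 2); split => //; first lra.
  by move=> y Dy; have := gmax y Dy; rewrite !addr0.
have AD : A `<=` D by move=> a [].
have e20 : 0 < e / 2 by lra.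
have [a0 [s [C [k [Aa0 sl sC k0 sA]]]]] := Dd A AD A0 _ e20.
have [Da0 [u0 [r0 [u0l r0d u0r u0max]]]] := Aa0.
pose gap := d - r0; have gap0 : 0 < gap by rewrite subr_gt0.
(* [t * s] uses less than half of the room [gap] left below [d], and [g] at most the other half. *)
pose t := gap / 2 / (`|C| + 1).
have C10 : 0 < `|C| + 1 by rewrite ltr_wpDl.
have t0 : 0 < t by rewrite divr_gt0 // divr_gt0.
have tC : `|t| * C < gap / 2.
  rewrite (gtr0_norm t0) /t mulrAC ltr_pdivrMr // ltr_pM2l ?divr_gt0 //.
  by have := ler_norm C; lra.
pose w v := u0 v + t * s v.
have wl : scalar w by apply: scalar_add => //; exact: scalar_mull.
have wd : dominated (r0 + `|t| * C) w.
  by apply: dominatedD => //; exact: dominatedZ.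
(* The second bound makes [g] vary by less than [t * k] on [D], whose points are at most [M + M]
   apart. *)
pose r := Num.min (gap / 2) (t * k / (2 * (M + M) + 1)).
have q0 : 0 < 2 * (M + M) + 1 by lra.
have tk0 : 0 < t * k by rewrite mulr_gt0.
have rp : 0 < r by rewrite lt_min !divr_gt0.
have rgap : r <= gap / 2 by rewrite ge_min lexx.
have rM : r * (M + M) < t * k.
  have : r * (2 * (M + M) + 1) <= t * k.
    by rewrite -ler_pdivlMr // ge_min lexx orbT.
  by have := mulr_ge0 (ltW rp) M0; lra.
(* [near_max] moves a maximizer up to [r * (e / 2)] by at most [e / 2]. *)
exists w, a0, (r * (e / 2)); split => //.
- by apply: dominated_le wd => //; rewrite /gap in tC; lra.
- by rewrite mulr_gt0.
move=> b Db bmax.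
have [b' [g [Db' bb' gl gr gmax]]] := near_max w _ r b wl wd rp Db.
have b'b : N (b' - b) <= e / 2.
  (* The bound for [f + w] in [bmax] passes to the envelope [F], hence applies at [b']. *)
  rewrite -(ler_pM2l rp).
  by have := FP w _ _ wl wd bmax b' Db'; have := fF b Db; lra.
have Ab' : A b'.
  split => //; exists (fun v => w v + g v), (r0 + `|t| * C + r); split.
  - exact: scalar_add.
  - by rewrite /gap in tC rgap; lra.
  - exact: dominatedD.
  - by move=> y Dy; have := gmax y Dy; lra.
have b'a : N (b' - a0) <= e / 2.
  (* Monotonicity: adding the maximality of [a0] for [u0] and of [b'] for [w + g] gives
     [t * (s a0 - s b') <= g b' - g a0 < t * k]. *)
  rewrite leNgt; apply/negP => /ltW far; have := sA b' Ab' far.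
  have h1 := u0max b' Db'; have h2 := gmax a0 Da0.
  have h3 : g b' - g a0 <= r * (M + M).
    rewrite -(is_scalarB gl); apply: le_trans (ler_norm _) _.
    apply: le_trans (gr _) _; rewrite ler_pM2l //.
    apply: le_trans (norm_add Nnorm _ _) _; rewrite (norm_opp Nnorm).
    by rewrite lerD ?DM.
  rewrite /w in h2 => sb; have := ler_wpM2l (ltW t0) sb; lra.
by apply: le_trans (norm_dist Nnorm b b' a0) _; rewrite (norm_distC Nnorm b); lra.
Qed.

(** The small-slice lemma is iterated: functionals [u n] with tolerances [s n], each step at most
    half of the current tolerance. Their limit [w] keeps small sets of almost maximizers at every
    scale, so all maximizing sequences converge to one point. *)
Theorem stegall D f (M d : R) :
  is_convex D -> complete_on D -> slice_dentable D -> D !=set0 ->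
  (forall y, D y -> N y <= M) -> (exists B, forall y, D y -> f y <= B) ->
  usc_on D f -> 0 < d ->
  exists w y0, [/\ scalar w, dominated d w, D y0,
    forall y, D y -> f y + w y <= f y0 + w y0 &
    forall e, 0 < e -> exists2 h, 0 < h &
      forall b, D b -> (forall y, D y -> f y + w y <= f b + w b + h) ->
        N (b - y0) <= e].
Proof.
move=> Dc Dcomp Dd [b0 Db0] DM [B fB] fusc d0.
have M0 : 0 <= M by apply: le_trans (norm_ge0 Nnorm b0) (DM b0 Db0).
have fub u r : dominated r u -> exists C, forall y, D y -> f y + u y <= C.
  move=> ur; exists (B + `|r| * M) => y Dy; apply: lerD; first exact: fB.
  apply: le_trans (ler_norm _) _; apply: le_trans (ur y) _.
  apply: le_trans (ler_wpM2r (norm_ge0 Nnorm y) (ler_norm r)) _.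
  by rewrite ler_wpM2l // DM.
have q0 : 0 < 2 * M + 1 by lra.
pose good (us : (V -> R) * R) :=
  [/\ scalar us.1, exists r, dominated r us.1 & 0 < us.2].
pose tol k : R := k.+1%:R^-1.
have tol0 k : 0 < tol k by rewrite invr_gt0.
(* The tolerance s (2 M + 1) ensures that every functional within s of u still
   has its s-maximizers near a. *)
pose small (us : (V -> R) * R) k := exists a, forall b, D b ->
  (forall y, D y -> f y + us.1 y <= f b + us.1 b + us.2 * (2 * M + 1)) ->
  N (b - a) <= tol k.
have next (x : nat * ((V -> R) * R)) : exists us', good x.2 ->
    [/\ good us', dominated (x.2.2 / 2) (fun v => us'.1 v - x.2.1 v),
      us'.2 <= x.2.2 / 2, us'.2 <= tol x.1 & small us' x.1].
  case: x => k [u s] /=; have [[ul [r ur] s0]|] := pselect (good (u, s));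
    last by exists (u, s).
  have s20 : 0 < s / 2 by move: s0 => /=; lra.
  have [C fuC] := fub u r ur.
  have [w [a [h [wl wd h0 wP]]]] := @small_slice_perturbation D
    (fun y => f y + u y) M (s / 2) (tol k) Dc Dcomp Dd
    (ex_intro _ b0 Db0) DM (ex_intro _ C fuC) s20 (tol0 k).
  (* [h / (2 * M + 1)] makes the enlarged tolerance at most [h]; [s / 2] makes the steps summable,
     and [tol k] drives the tolerances to 0. *)
  exists (fun v => u v + w v, Num.min (h / (2 * M + 1)) (Num.min (s / 2) (tol k))).
  move=> _; split => /=.
  - split => /=; first exact: scalar_add.
      by exists (r + s / 2); exact: dominatedD.
    by rewrite !lt_min s20 tol0 divr_gt0.
  - by move=> v; rewrite addrC addKr.
  - by rewrite !ge_min lexx !orbT.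
  - by rewrite !ge_min lexx !orbT.
  - exists a => b Db bmax; apply: wP => // y Dy.
    rewrite -!addrA; apply: le_trans (bmax y Dy) _; rewrite -!addrA !lerD2l.
    by rewrite -ler_pdivlMr // ge_min lexx.
have [step stepP] := choice next.
pose us := nat_rect (fun=> ((V -> R) * R)%type) ((fun=> 0), d)
  (fun n p => step (n, p)).
have usg n : good (us n).
  elim: n => [|n IH]; last by have [] := stepP (n, us n) IH.
  split => //; first exact: scalar_cst0.
  by exists 0; exact: (dominated0 Nnorm).
pose u n := (us n).1; pose s n := (us n).2.
have ul n : scalar (u n) by case: (usg n).
have s0 n : 0 < s n by case: (usg n).
have ustep n v : `|u n.+1 v - u n v| <= s n / 2 * N v.
  by have [_ h _ _ _] := stepP (n, us n) (usg n); exact: h.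
have sstep n : s n.+1 <= s n / 2 by case: (stepP (n, us n) (usg n)).
have stol n : s n.+1 <= tol n by case: (stepP (n, us n) (usg n)).
have ssmall n : small (us n.+1) n by case: (stepP (n, us n) (usg n)).
(* Because [s n.+1 <= s n / 2], the step [s n / 2] is at most [s n - s n.+1], and the bounds
   telescope. *)
have udist k n v : (k <= n)%N -> `|u n v - u k v| <= (s k - s n) * N v.
  elim: n => [|n IH]; first by rewrite leqn0 => /eqP ->; rewrite !subrr normr0 mul0r.
  rewrite leq_eqVlt => /predU1P[->|]; first by rewrite !subrr normr0 mul0r.
  rewrite ltnS => /IH kn; rewrite -(subrK (u n v) (u n.+1 v)) -addrA.
  apply: le_trans (ler_normD _ _) _.
  have := ler_wpM2r (norm_ge0 Nnorm v) (sstep n); have := ustep n v; lra.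
have ubnd k n v : u k v - s k * N v <= u n v + s n * N v.
  have [kn|/ltnW nk] := leqP k n.
    have := udist k n v kn; rewrite ler_norml => /andP[h _].
    by have := mulr_ge0 (ltW (s0 n)) (norm_ge0 Nnorm v); lra.
  have := udist n k v nk; rewrite ler_norml => /andP[_ h].
  by have := mulr_ge0 (ltW (s0 k)) (norm_ge0 Nnorm v); lra.
(* The intervals around [u k v] of radius [s k * N v] meet pairwise by [ubnd]; the supremum of their
   left ends lies in all of them. *)
pose w v := sup ((fun k => u k v - s k * N v) @` setT).
have wu k v : `|w v - u k v| <= s k * N v.
  rewrite ler_norml; apply/andP; split.
    rewrite lerBrDl; apply: ub_le_sup; last by exists k.
    by exists (u 0 v + s 0 * N v) => _ [n _ <-].
  rewrite lerBlDl; apply: ge_sup; first by exists (u 0 v - s 0 * N v), 0%N.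
  by move=> _ [n _ <-].
have s_eq0 (x c : R) : (forall k, `|x| <= s k * c) -> x = 0.
  move=> xs; apply/eqP; rewrite -normr_eq0 eq_le normr_ge0 andbT.
  apply/ler_addgt0Pr => e e0; rewrite add0r.
  have k0 : 0 < e / (`|c| + 1) by rewrite divr_gt0 // ltr_wpDl.
  have [n nP] := ltr_invS_exists k0.
  apply: le_trans (xs n.+1) _.
  have h : s n.+1 <= e / (`|c| + 1).
    by apply: le_trans (stol n) _; rewrite ltW // nP.
  apply: le_trans (ler_wpM2l (ltW (s0 n.+1)) (ler_norm c)) _.
  move: h; rewrite ler_pdivlMr ?ltr_wpDl // => /(le_trans _); apply.
  by rewrite ler_wpM2l ?ltW //; lra.
have wl : scalar w.
  move=> a x y; apply/eqP; rewrite -subr_eq0; apply/eqP.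
  apply: (s_eq0 _ (N (a *: x + y) + `|a| * N x + N y)) => k.
  have -> : w (a *: x + y) - (a * w x + w y) =
    (w (a *: x + y) - u k (a *: x + y)) + - (a * (w x - u k x)) + - (w y - u k y).
    by rewrite (ul k); ring.
  apply: le_trans (ler_normD _ _) _; apply: le_trans (lerD (ler_normD _ _) (lexx _)) _.
  rewrite !normrN normrM.
  have := wu k (a *: x + y); have := wu k y.
  by have := ler_wpM2l (normr_ge0 a) (wu k x); lra.
have wd : dominated d w by move=> v; have := wu 0%N v; rewrite subr0.
have wsmall k : exists a, forall b, D b ->
    (forall y, D y -> f y + w y <= f b + w b + s k.+1) -> N (b - a) <= tol k.
  (* Replacing [w] by [u k.+1] costs [s k.+1 * M] at each of [y] and [b]; with the slack [s k.+1]
     this adds up to the tolerance [s k.+1 * (2 * M + 1)]. *)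
  have [a aP] := ssmall k; exists a => b Db bmax; apply: aP => // y Dy.
  rewrite -/(u k.+1) -/(s k.+1).
  have := bmax y Dy; have := wu k.+1 y; have := wu k.+1 b.
  rewrite !ler_norml => /andP[_ hb] /andP[hy _].
  have := ler_wpM2l (ltW (s0 k.+1)) (DM y Dy).
  have := ler_wpM2l (ltW (s0 k.+1)) (DM b Db).
  lra.
have bex n : exists b, D b /\ forall y, D y -> f y + w y <= f b + w b + tol n.
  have hs : has_sup ((fun y => f y + w y) @` D).
    split; first by exists (f b0 + w b0), b0.
    by have [C CP] := fub w d wd; exists C => _ [y Dy <-]; exact: CP.
  have [_ [b Db <-] lt] := sup_adherent (tol0 n) hs.
  exists b; split => // y Dy.
  have : f y + w y <= sup ((fun y => f y + w y) @` D).
    by apply: ub_le_sup; [case: hs|exists y].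
  lra.
have [b /all_and2[Db bmax]] := choice bex.
have bnear k : exists n0 a, (forall n, (n0 <= n)%N -> N (b n - a) <= tol k) /\
    (forall b', D b' -> (forall y, D y -> f y + w y <= f b' + w b' + s k.+1) ->
      N (b' - a) <= tol k).
  have [a aP] := wsmall k; have [n0 nP] := ltr_invS_exists (s0 k.+1).
  exists n0, a; split => // n n0n; apply: aP => // y Dy.
  by apply: le_trans (bmax n y Dy) _; rewrite lerD2l ltW // nP.
have [|y0 Dy0 by0] := Dcomp b Db.
  move=> e e0; have e20 : 0 < e / 2 by lra.
  have [k kP] := ltr_invS_exists e20; have {}kP := kP k (leqnn k).
  have [n0 [a [aP _]]] := bnear k; exists n0 => n n0n.
  apply: le_trans (norm_dist Nnorm _ a _) _; rewrite (norm_distC Nnorm a).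
  have := aP n n0n; have := aP n0 (leqnn n0).
  by rewrite /tol; move: (k.+1%:R^-1) kP => t; lra.
exists w, y0; split => // [y Dy|e e0].
  (* [y0] is the limit of the maximizing sequence [b n], and upper semicontinuity passes its bounds
     on to [y0]. *)
  apply/ler_addgt0Pl => e e0; have e20 : 0 < e / 2 by lra.
  have [r r0 rP] := usc_on_add_dominated fusc wl wd Dy0 e20.
  have [n0 n0P] := by0 r r0; have [n1 n1P] := ltr_invS_exists e20.
  pose n := maxn n0 n1.
  have := rP (b n) (Db n) (n0P n (leq_maxl _ _)).
  have := n1P n (leq_maxr _ _); have := bmax n y Dy.
  by rewrite /tol; move: (n.+1%:R^-1) => t; lra.
have e30 : 0 < e / 3 by lra.
have [k kP] := ltr_invS_exists e30; have {}kP := kP k (leqnn k).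
have [n0 [a [aP a'P]]] := bnear k; exists (s k.+1) => // b' Db' b'max.
have [n1 n1P] := by0 _ e30; pose n := maxn n0 n1.
have := n1P n (leq_maxr _ _); have := aP n (leq_maxl _ _).
have := a'P b' Db' b'max.
have := norm_dist Nnorm b' a y0; have := norm_dist Nnorm a (b n) y0.
by rewrite (norm_distC Nnorm a (b n)) /tol; move: (k.+1%:R^-1) kP => t; lra.
Qed.

End Stegall.

(** * Real and complex scalars *)

(* What the proof uses of the scalar field: a real part, and the real numbers
   as a subfield, in such a way that real functionals are real parts. *)
Record realification (R : realType) (K : numFieldType) := Realification {
  emb : {rmorphism R -> K};
  re : K -> R;
  emb_le : forall r s, (emb r <= emb s) = (r <= s);
  embK : forall k, 0 <= k -> emb (re k) = k;
  re_add : {morph re : k l / k + l};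
  re_embM : forall r k, re (emb r * k) = r * re k;
  re_le_norm : forall k, re k <= re `|k|;
  functional_lift : forall (Y : lmodType K) (phi : Y -> R),
    {morph phi : x y / x + y} -> (forall r y, phi (emb r *: y) = r * phi y) ->
    exists2 psi : Y -> K, scalar psi & forall y, re (psi y) = phi y;
  unit_subseq : forall theta : nat -> K, (forall n, `|theta n| = 1) ->
    exists (sigma : nat -> nat) (t : K), increasing_seq sigma /\
      forall e : R, 0 < e -> exists n0, forall n, (n0 <= n)%N ->
        re `|theta (sigma n) - t| < e }.

(** An alias that carries the real scalar multiplication through [emb E], kept apart from the one
    over [K]. *)
Definition realified {R : realType} {K : numFieldType}
  (E : realification R K) (Y : lmodType K) : Type := Y.

(** * Normed spaces over [K] as real seminormed spaces *)

Section Realified.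
Context {R : realType} {K : numFieldType} (E : realification R K).
Implicit Types (k : K) (r s : R).

Section Lmodule.
Context (Y : lmodType K).
Let V := realified E Y.
HB.instance Definition _ := GRing.Zmodule.on V.

Let scale (r : R) (y : V) : V := emb E r *: (y : Y).

Let scaleA r s y : scale r (scale s y) = scale (r * s) y.
Proof. by rewrite /scale scalerA rmorphM. Qed.

Let scale1 : left_id 1 scale.
Proof. by move=> y; rewrite /scale rmorph1 scale1r. Qed.

Let scaleDr : right_distributive scale +%R.
Proof. by move=> r x y; rewrite /scale scalerDr. Qed.

Let scaleDl y : {morph scale^~ y : r s / r + s}.
Proof. by move=> r s; rewrite /scale rmorphD scalerDl. Qed.

HB.instance Definition _ :=
  GRing.Zmodule_isLmodule.Build R V scaleA scale1 scaleDr scaleDl.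
End Lmodule.

Lemma realified_scale (Y : lmodType K) r (y : Y) :
  r *: (y : realified E Y) = emb E r *: y.
Proof. by []. Qed.

Lemma emb_lt r s : (emb E r < emb E s) = (r < s).
Proof. by rewrite !lt_neqAle emb_le (inj_eq (fmorph_inj _)). Qed.

Lemma emb_ge0 r : (0 <= emb E r) = (0 <= r).
Proof. by rewrite -{1}(rmorph0 (emb E)) emb_le. Qed.

Lemma re_emb r : re E (emb E r) = r.
Proof.
have re1 : re E 1 = 1.
  by apply: (fmorph_inj (emb E)); rewrite embK ?ler01 // rmorph1.
by rewrite -[emb E r]mulr1 re_embM re1 mulr1.
Qed.

Lemma emb_norm r : `|emb E r| = emb E `|r|.
Proof.
have [r0|/ltW r0] := leP 0 r; first by rewrite !ger0_norm ?emb_ge0.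
rewrite !ler0_norm ?rmorphN //.
by rewrite -(rmorph0 (emb E)) emb_le.
Qed.

Definition nrm (W : normedZmodType K) (y : W) : R := re E `|y|.
Arguments nrm {W}.

Lemma emb_nrm (W : normedZmodType K) (y : W) : emb E (nrm y) = `|y|.
Proof. by rewrite embK. Qed.

Lemma nrm_emb r : nrm (emb E r) = `|r|.
Proof. by rewrite /nrm emb_norm re_emb. Qed.

Lemma nrm_add (W : normedZmodType K) (x y : W) : nrm (x + y) <= nrm x + nrm y.
Proof. by rewrite -(emb_le E) rmorphD !emb_nrm ler_normD. Qed.

Lemma nrm_scale (Y : normedModType K) k (y : Y) : nrm (k *: y) = nrm k * nrm y.
Proof. by apply: (fmorph_inj (emb E)); rewrite rmorphM !emb_nrm normrZ. Qed.

Lemma nrm_eq0 (W : normedZmodType K) (y : W) : nrm y = 0 -> y = 0.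
Proof.
by move=> y0; apply/eqP; rewrite -normr_eq0 -emb_nrm y0 rmorph0.
Qed.

Lemma nrm_seminorm (Y : normedModType K) :
  is_seminorm (@nrm Y : realified E Y -> R).
Proof.
split => [x y|a x]; first exact: nrm_add.
by rewrite realified_scale nrm_scale nrm_emb.
Qed.

Lemma emb_reP k : 0 < k -> exists2 r, 0 < r & k = emb E r.
Proof.
move=> k0; have kE := embK E (ltW k0); exists (re E k) => //.
by rewrite -emb_lt kE rmorph0.
Qed.

Lemma nrm_lt (W : normedZmodType K) (y : W) r : (nrm y < r) = (`|y| < emb E r).
Proof. by rewrite -emb_lt emb_nrm. Qed.

Lemma closure_nrmP (W : pseudoMetricNormedZmodType K) (A : set W) y :
  closure A y <-> forall e, 0 < e -> exists2 x, A x & nrm (x - y) < e.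
Proof.
split => [Ay e e0|Ay B].
  have e0' : 0 < emb E e by rewrite -(rmorph0 (emb E)) emb_lt.
  have [x [Ax]] := Ay _ (nbhsx_ballx y _ e0').
  by rewrite -ball_normE /= distrC => yx; exists x => //; rewrite nrm_lt.
move=> /nbhs_ballP[k /= /emb_reP[r r0 ->] kB].
have [x Ax xy] := Ay r r0; exists x; split => //; apply: kB.
by rewrite -ball_normE /= distrC -nrm_lt.
Qed.

Lemma cvg_nrmP (W : pseudoMetricNormedZmodType K) (u : nat -> W) l :
  u n @[n --> \oo] --> l <->
  forall e, 0 < e -> exists n0, forall n, (n0 <= n)%N -> nrm (u n - l) < e.
Proof.
split => [/cvgrPdist_lt ul e e0|ul].
  have e0' : 0 < emb E e by rewrite -(rmorph0 (emb E)) emb_lt.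
  have [n0 _ n0P] := ul _ e0'; exists n0 => n /n0P.
  by rewrite /= distrC -nrm_lt.
apply/cvgrPdist_lt => k /emb_reP[r r0 ->].
have [n0 n0P] := ul r r0; exists n0 => // n /= /n0P.
by rewrite distrC nrm_lt.
Qed.

Lemma is_convex_realified (Y : lmodType K) (C : set Y) :
  convex_set C -> is_convex (C : set (realified E Y)).
Proof.
move=> Cc x y t Cx Cy t0 t1.
have et0 : 0 <= emb E t by rewrite emb_ge0.
have et1 : emb E t <= 1 by rewrite -(rmorph1 (emb E)) emb_le.
have := Cc x y (Itv01 et0 et1) (mem_set Cx) (mem_set Cy).
by move=> /set_mem; rewrite !realified_scale rmorphB rmorph1.
Qed.

Lemma complete_on_realified (Y : completeNormedModType K) (D : set Y) :
  closed D -> complete_on (@nrm Y : realified E Y -> R) (D : set (realified E Y)).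
Proof.
move=> Dcl u Du uc.
have : cauchy (u n @[n --> \oo] : set_system Y).
  apply: cauchy_exP => k /emb_reP[r r0 ->].
  have r20 : 0 < r / 2 by lra.
  have [n0 n0P] := uc _ r20; exists (u n0); exists n0 => // n /= nn0.
  rewrite -ball_normE /= distrC -nrm_lt.
  by apply: le_lt_trans (n0P n nn0) _; lra.
move=> /cauchy_cvgP /cvg_ex[l ul]; exists l; last exact/cvg_nrmP.
by apply: (closed_cvg D Dcl _ l ul); exists 0%N => // n _; exact: Du.
Qed.

(** A point outside the closed convex hull has positive distance [k] from some closed convex set
    containing the far points. The sandwich lemma with the constant function [- k] and slope 1 then
    separates the two strictly. *)
Lemma slice_dentable_realified (Y : completeNormedModType K) (D : set Y) :
  RNP_set D -> slice_dentable (@nrm Y : realified E Y -> R) (D : set (realified E Y)).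
Proof.
move=> [_ _ Dd] A AD A0 d d0.
have d0' : 0 < emb E d by rewrite -(rmorph0 (emb E)) emb_lt.
have [a Aa aH] := Dd A AD A0 _ d0'.
have [C [[Ccl Cc] AC] Ca] : exists2 C : set Y, (closed C /\ convex_set C) /\
    A `\` [set b | `|b - a| < emb E d] `<=` C & ~ C a.
  apply: contrapT => nC; apply: aH => C [CC AC]; apply: contrapT => Ca.
  by apply: nC; exists C.
have [k k0 kC] : exists2 k, 0 < k & forall h, C h -> k <= nrm (h - a).
  apply: contrapT => nk; apply: Ca; apply: Ccl; apply/closure_nrmP => e e0.
  apply: contrapT => nx; apply: nk; exists e => // h Ch.
  by rewrite leNgt; apply/negP => he; apply: nx; exists h.
have [|y Cy|w [wl w1 wC]] := @lipschitz_sandwich R (realified E Y) (@nrm Y)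
    (nrm_seminorm Y) C (fun=> - k) a 1 (is_convex_realified Cc) _ ler01.
- by move=> x y t _ _ _ _; lra.
- by rewrite mul1r; have := kC y Cy; lra.
exists a, w, 1, k; split => // b Ab dab.
have Cb : C b by apply: AC; split => //=; rewrite -nrm_lt ltNge dab.
by have := wC b Cb; rewrite (is_scalarB wl); lra.
Qed.

Lemma phase k : exists2 t : K, `|t| = 1 & t * k = `|k|.
Proof.
have [->|k0] := eqVneq k 0; first by exists 1; rewrite ?normr1 // mulr0 normr0.
exists (`|k| / k); last by rewrite divfK.
by rewrite normrM normfV normr_id divff // normr_eq0.
Qed.

End Realified.
Arguments nrm {R K} E {W} y.

(** * Realifications of the real and the complex field *)

Lemma increasing_seq_ge (sigma : nat -> nat) (n : nat) :
  increasing_seq sigma -> (n <= sigma n)%N.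
Proof.
move=> sinc; elim: n => // n IH; apply: leq_ltn_trans IH _.
have h : (sigma n.+1 <= sigma n)%N = false by rewrite -leEnat sinc ltnn.
by rewrite ltnNge h.
Qed.

Lemma bounded_subseq (R : realType) (u : nat -> R) : (forall n, `|u n| <= 1) ->
  exists (sigma : nat -> nat) (l : R), increasing_seq sigma /\
    forall e, 0 < e -> exists n0, forall n, (n0 <= n)%N ->
      `|u (sigma n) - l| < e.
Proof.
move=> u1; have [|sigma sinc /cvg_ex[l /cvgrPdist_lt ul]] := @bolzano_weierstrass R u.
  by exists 1; split; [exact: num_real|move=> M /ltW M1 n _; exact: le_trans (u1 n) M1].
exists sigma, l; split => // e /ul[n0 _ n0P]; exists n0 => n /n0P.
by rewrite distrC.
Qed.

Definition realification_real (R : realType) : realification R (R : numFieldType).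
Proof.
apply: (@Realification R (R : numFieldType) idfun id) => //.
- by move=> k; exact: ler_norm.
- move=> Y phi phiD phiZ; exists phi => // a x y.
  by rewrite phiD phiZ.
move=> theta theta1; have [|sigma [t [sinc st]]] := @bounded_subseq R theta.
  by move=> n; rewrite theta1.
by exists sigma, t.
Defined.

Lemma sqrtr_sum_sqr_le (R : rcfType) (x y : R) :
  Num.sqrt (x ^+ 2 + y ^+ 2) <= `|x| + `|y|.
Proof.
have xy0 : 0 <= `|x| + `|y| by rewrite addr_ge0.
rewrite -[leRHS](ger0_norm xy0) -[leRHS]sqrtr_sqr ler_wsqrtr //.
rewrite sqrrD !real_normK ?num_real // addrAC lerDl.
by rewrite mulrn_wge0 // mulr_ge0.
Qed.

Section ComplexScalars.
Local Open Scope complex_scope.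
Context {R : realType}.

(** The usual complexification [phi y - i * phi (i * y)]. *)
Lemma complex_functional_lift (Y : lmodType R[i]) (phi : Y -> R) :
  {morph phi : x y / x + y} -> (forall (r : R) y, phi (r%:C *: y) = r * phi y) ->
  exists2 psi : Y -> R[i], scalar psi & forall y, complex.Re (psi y) = phi y.
Proof.
move=> phiD phiZ.
have phiC (p q : R) y : phi ((p +i* q) *: y) = p * phi y + q * phi ('i *: y).
  have -> : p +i* q = p%:C + q%:C * 'i :> R[i].
    by apply/eqP; rewrite eq_complex /=; apply/andP; split; apply/eqP; ring.
  by rewrite scalerDl phiD -scalerA !phiZ.
exists (fun y => phi y -i* phi ('i *: y)) => //.
move=> [p q] x y /=; rewrite scalerDr scalerA !phiD.
have -> : 'i * (p +i* q) = (- q) +i* p :> R[i].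
  by apply/eqP; rewrite eq_complex /=; apply/andP; split; apply/eqP; ring.
rewrite (phiC p q) (phiC (- q) p); apply/eqP; rewrite eq_complex /=.
by apply/andP; split; apply/eqP; ring.
Qed.

(** Bolzano-Weierstrass is applied to the real parts, then to the imaginary parts along the first
    subsequence. *)
Lemma complex_unit_subseq (theta : nat -> R[i]) : (forall n, `|theta n| = 1) ->
  exists (sigma : nat -> nat) (t : R[i]), increasing_seq sigma /\
    forall e : R, 0 < e -> exists n0, forall n, (n0 <= n)%N ->
      complex.Re `|theta (sigma n) - t| < e.
Proof.
move=> theta1.
have [|s1 [a [s1inc s1a]]] := @bounded_subseq R (fun n => complex.Re (theta n)).
  by move=> n; rewrite -lecR rmorph1 -(theta1 n) normc_ge_Re.
have [|s2 [b [s2inc s2b]]] := @bounded_subseq R (fun n => complex.Im (theta (s1 n))).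
  move=> n; rewrite -lecR rmorph1 -(theta1 (s1 n)).
  have := normc_ge_Re (theta (s1 n) * 'i).
  rewrite ReiNIm normrN normrM => /le_trans; apply.
  by rewrite (_ : `|'i| = 1) ?mulr1 // complexiE normCi.
exists (s1 \o s2), (a +i* b); split.
  by move=> n m; rewrite /= s1inc -leEnat s2inc.
move=> e e0; have e20 : 0 < e / 2 by lra.
have [n1 n1P] := s1a _ e20; have [n2 n2P] := s2b _ e20.
exists (maxn n1 n2) => n; rewrite geq_max => /andP[nn1 nn2] /=.
have h1 := n1P (s2 n) (leq_trans nn1 (increasing_seq_ge n s2inc)).
have h2 := n2P n nn2.
set z := theta (s1 (s2 n)) in h1 h2 *.
apply: (@le_lt_trans _ _ (`|complex.Re z - a| + `|complex.Im z - b|)); last lra.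
case: z {h1 h2} => p q /=.
exact: sqrtr_sum_sqr_le.
Qed.

Definition realification_complex : realification R (R[i] : numFieldType).
Proof.
apply: (@Realification R (R[i] : numFieldType) (real_complex R) (@complex.Re R)).
- by move=> r s; exact: lecR.
- by move=> k k0; exact: RRe_real (ger0_real k0).
- by move=> [? ?] [? ?].
- by move=> r [p q] /=; rewrite mul0r subr0.
- move=> [p q]; rewrite normc_def /=.
  by apply: le_trans (ler_norm _) _; rewrite -sqrtr_sqr ler_wsqrtr // lerDl sqr_ge0.
- exact: complex_functional_lift.
- exact: complex_unit_subseq.
Defined.

End ComplexScalars.

(** * Perturbing strong Radon-Nikodym operators *)

Section OperatorNorm.
Context {K : numFieldType} {X Y : normedModType K}.

(** As the order of [K] may be partial, a least upper bound has to be exhibited; by uniqueness it is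
    the one that [supremum] picks. *)
Lemma opnormE (f : X -> Y) (c : K) : (forall x, `|x| <= 1 -> `|f x| <= c) ->
  (forall k, (forall x, `|x| <= 1 -> `|f x| <= k) -> c <= k) -> opnorm f = c.
Proof.
move=> fc cmin; rewrite /opnorm /supremum.
set A := (X in X == set0).
have A0 : A !=set0.
  by exists `|f 0|, 0 => //; rewrite /closed_unit_ball /= normr0.
have cA : supremums A c.
  split => [_ [x Bx <-]|k kA]; first exact: fc.
  by apply: cmin => x Bx; apply: kA; exists x.
rewrite ifF; last by apply/eqP => A_eq0; move: A0; rewrite A_eq0 => -[].
by case: xgetP => [k _ kA|/(_ c)//]; exact: is_subset1_supremums kA cA.
Qed.

(** If the norms have no supremum in [K], [opnorm f] is the default value 0, which [0 <= c]
    covers. *)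
Lemma opnorm_le (f : X -> Y) (c : K) : 0 <= c ->
  (forall x, `|x| <= 1 -> `|f x| <= c) -> opnorm f <= c.
Proof.
move=> c0 fc; rewrite /opnorm /supremum; case: ifP => // _.
case: xgetP => [k _ [_ kle]|_ //]; apply: kle => _ [x Bx <-]; exact: fc.
Qed.

End OperatorNorm.

Section StrongRadonNikodym.
Context {R : realType} {K : numFieldType} (E : realification R K).
Context {X Y : completeNormedModType K}.
Local Notation nrm := (nrm E).
Local Notation emb := (emb E).
Local Notation re := (re E).

Lemma closed_ball_image_phase (T : {linear X -> Y}) (t : K) y : `|t| = 1 ->
  closed_ball_image T y -> closed_ball_image T (t *: y).
Proof.
move=> t1 /(closure_nrmP E) Dy; apply/(closure_nrmP E) => e e0.
have [_ [x Bx <-] xy] := Dy e e0; exists (T (t *: x)).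
  by exists (t *: x) => //; rewrite /closed_unit_ball /= normrZ t1 mul1r.
by rewrite linearZ -scalerBr /nrm normrZ t1 mul1r.
Qed.

Lemma bounded_operator_nrm (T : {linear X -> Y}) : bounded_operator T ->
  exists2 M : R, 0 <= M & forall x, `|x| <= 1 -> nrm (T x) <= M.
Proof.
(* Boundedness makes every number above [M0] a bound, and [|M0| + 1] is one. *)
move=> [M0 [M0r TM]]; exists (re (`|M0| + 1)).
  by rewrite -(emb_ge0 E) embK // addr_ge0.
have M1 : M0 < `|M0| + 1.
  by apply: le_lt_trans (real_ler_norm M0r) _; rewrite ltrDl.
move=> x Bx; have := TM _ M1 x Bx.
by rewrite -(emb_le E) emb_nrm embK // addr_ge0.
Qed.

(** Stegall's theorem for the norm gives a real functional [w], and [psi] lifts it. Rotation by a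
    phase turns [w] into the modulus of [psi] without leaving the closed ball image, so the norm
    plus either of them has the same supremum. *)
Lemma strongly_maximizing_perturbation (T : {linear X -> Y}) (d : R) :
  bounded_operator T -> strong_Radon_Nikodym T -> 0 < d ->
  exists (psi : {scalar Y}) (y0 : Y), [/\ closed_ball_image T y0,
    forall y, nrm (psi y) <= d * nrm y,
    0 <= psi y0,
    forall y, closed_ball_image T y ->
      nrm y + nrm (psi y) <= nrm y0 + nrm (psi y0) &
    forall e, 0 < e -> exists2 h, 0 < h & forall y, closed_ball_image T y ->
      0 <= psi y -> nrm y0 + nrm (psi y0) <= nrm y + nrm (psi y) + h ->
      nrm (y - y0) <= e].
Proof.
move=> Tb TRN d0; set D := closed_ball_image T.
have [M M0 TM] := bounded_operator_nrm Tb.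
have [Dcl Dc _] := TRN.
have DT x : `|x| <= 1 -> D (T x) by move=> Bx; apply: subset_closure; exists x.
have DM y : D y -> nrm y <= M.
  move=> /(closure_nrmP E) Dy; apply/ler_addgt0Pl => e e0.
  have [_ [x Bx <-] xy] := Dy e e0.
  have := nrm_add E (y - T x) (T x); rewrite subrK.
  have := TM x Bx; move: xy; rewrite {1}/nrm distrC -/(nrm _); lra.
have usc : usc_on (nrm : realified E Y -> R) D nrm.
  move=> l Dl e e0; exists e => // y Dy yl.
  by have := nrm_add E (y - l) l; rewrite subrK; lra.
have D0 : D !=set0 by exists (T 0); apply: DT; rewrite normr0.
have [w [y0 [wl wd Dy0 wmax wstrong]]] := @stegall R (realified E Y) nrm
  (nrm_seminorm E Y) D nrm M d (is_convex_realified Dc)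
  (complete_on_realified Dcl) (slice_dentable_realified TRN) D0 DM
  (ex_intro _ M DM) usc d0.
have [psi psil psire] := functional_lift (r0 := E) (is_scalarD wl) (is_scalarZ wl).
have psiZ k y : psi (k *: y) = k * psi y.
  have psi0 : psi 0 = 0 by have := psil (-1) 0 0; rewrite scaler0 addr0 mulN1r addNr.
  by have := psil k y 0; rewrite addr0 psi0 addr0.
have w_phase y : exists t : K, [/\ `|t| = 1, t * psi y = `|psi y| &
    w (t *: y) = nrm (psi y)].
  have [t t1 tpsi] := phase (psi y).
  by exists t; split; rewrite // -psire psiZ tpsi.
have nrm_phase (t : K) (y : Y) : `|t| = 1 -> nrm (t *: y) = nrm y.
  by move=> t1; rewrite /nrm normrZ t1 mul1r.
have w_le y : w y <= nrm (psi y) by rewrite -psire; exact: re_le_norm.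
have w_pos y : 0 <= psi y -> w y = nrm (psi y).
  by move=> psiy; rewrite -psire /nrm ger0_norm.
have psiy0 : psi y0 = `|psi y0|.
  have [t [t1 tpsi wt]] := w_phase y0.
  (* The rotated point [t *: y0] does at least as well as [y0], so strong maximality identifies the
     two. *)
  suff ty0 : t *: y0 = y0 by rewrite -tpsi -psiZ ty0.
  apply/eqP; rewrite -subr_eq0; apply/eqP/(nrm_eq0 (E := E))/eqP.
  rewrite eq_le; apply/andP; split; last exact: (norm_ge0 (nrm_seminorm E Y)).
  apply/ler_addgt0Pl => e e0; rewrite addr0.
  have [h h0 hP] := wstrong e e0; apply: hP.
    exact: closed_ball_image_phase.
  move=> y Dy; rewrite nrm_phase // wt.
  by have := wmax y Dy; have := w_le y0; lra.
have psiy0_ge0 : 0 <= psi y0 by rewrite psiy0.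
have psiS : GRing.linear_for *%R psi by [].
pose psiL : {scalar Y} := HB.pack psi (GRing.isLinear.Build K Y K *%R psi psiS).
exists psiL, y0; split => //= [y|y Dy|e e0].
- have [t [t1 _ <-]] := w_phase y.
  by apply: le_trans (ler_norm _) _; rewrite -(nrm_phase t) // wd.
- have [t [t1 _ <-]] := w_phase y.
  rewrite -(nrm_phase t y) // -(w_pos y0) //.
  by apply: wmax; exact: closed_ball_image_phase.
- have [h h0 hP] := wstrong e e0; exists h => // y Dy psiy ymax.
  apply: hP => // y' Dy'; have := wmax y' Dy'.
  by rewrite (w_pos y0) // (w_pos y) //; lra.
Qed.

Theorem strong_Radon_Nikodym_perturbation (eps : K) (T : {linear X -> Y}) :
  0 < eps -> bounded_operator T -> strong_Radon_Nikodym T ->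
  exists S : {linear X -> Y},
    [/\ QNA S,
        opnorm (S \- T) < eps &
        exists z0 : Y,
          [/\ closed_ball_image S z0,
              `|z0| = opnorm S &
              forall x : nat -> X,
                (forall n, closed_unit_ball X (x n)) ->
                `|S (x n)| @[n --> \oo] --> opnorm S ->
                (exists theta : nat -> K,
                  (forall n, `|theta n| = 1) /\
                  S (theta n *: x n) @[n --> \oo] --> z0) /\
                (exists (theta0 : K) (sigma : nat -> nat),
                  [/\ `|theta0| = 1,
                      increasing_seq sigma &
                      S (x (sigma n)) @[n --> \oo] --> theta0 *: z0])]].
Proof.
move=> /(emb_reP E)[e0 e00 ->] Tb TRN.
have [M M0 TM] := bounded_operator_nrm Tb.
have M10 : 0 < 2 * (M + 1) by lra.
(* [d * M] will bound the norm of the perturbation; [M + 1] keeps the denominator positive. *)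
pose d := e0 / (2 * (M + 1)); have d0 : 0 < d by rewrite divr_gt0.
have dM : d * M < e0.
  have : d * (2 * (M + 1)) = e0 by rewrite divfK // gt_eqF.
  by have := mulr_ge0 (ltW d0) M0; lra.
have [psi [y0 [Dy0 psid psiy0 ymax ystrong]]] :=
  strongly_maximizing_perturbation Tb TRN d0.
pose u := `|y0|^-1 *: y0.
pose L (y : Y) := y + psi y *: u.
have L_lin : linear L.
  move=> a y y'; rewrite /L linearP scalerDl scalerDr scalerA.
  by rewrite addrACA.
have LZ (a : K) y : L (a *: y) = a *: L y.
  by rewrite /L scalarZ scalerDr -scalerA.
have LB y y' : L (y - y') = L y - L y'.
  by rewrite -scaleN1r addrC L_lin addrC scaleN1r.
have S_lin : linear (fun x => L (T x)) by move=> a x x'; rewrite linearP L_lin.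
pose S : {linear X -> Y} :=
  HB.pack (fun x => L (T x)) (GRing.isLinear.Build K X Y *:%R _ S_lin).
have SE x : S x = L (T x) by [].
have nrm0 (W : normedZmodType K) (y : W) : 0 <= nrm y.
  by rewrite -(emb_ge0 E) emb_nrm.
have u1 : nrm u <= 1.
  rewrite -(emb_le E) emb_nrm rmorph1 normrZ normfV normr_id.
  by have [->|y0n] := eqVneq `|y0| 0; rewrite ?mulr0 ?ler01 // mulVf.
have psiu y : nrm (psi y *: u) <= nrm (psi y).
  by rewrite nrm_scale ler_piMr.
have L_le y : nrm (L y) <= nrm y + nrm (psi y).
  by apply: le_trans (nrm_add E _ _) _; rewrite lerD2l.
have L_lip y : nrm (L y) <= (1 + d) * nrm y.
  by have := L_le y; have := psid y; lra.
pose c := nrm y0 + nrm (psi y0); pose z0 := L y0.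
(* [psi y0] is nonnegative, so [psi y0 *: u] points in the direction of [y0] and the norms add
   up. *)
have z0c : nrm z0 = c.
  apply: (fmorph_inj emb); rewrite emb_nrm rmorphD !emb_nrm.
  have [y00|y00] := eqVneq y0 0.
    by rewrite /z0 /L y00 linear0 scale0r addr0 !normr0 addr0.
  have ny0 : `|y0| != 0 by rewrite normr_eq0.
  have -> : z0 = ((`|y0| + `|psi y0|) / `|y0|) *: y0.
    rewrite mulrDl divff // scalerDl scale1r /z0 /L /u scalerA.
    by rewrite (ger0_norm psiy0).
  by rewrite normrZ normrM normfV normr_id mulfVK // ger0_norm // addr_ge0.
have DT x : `|x| <= 1 -> closed_ball_image T (T x).
  by move=> Bx; apply: subset_closure; exists x.
have S_le x : `|x| <= 1 -> nrm (S x) <= c.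
  by move=> Bx; apply: le_trans (L_le _) _; exact: ymax (DT x Bx).
have Dz0 : closed_ball_image S z0.
  apply/(closure_nrmP E) => e ep.
  have d10 : 0 < 1 + d by lra.
  have [_ [x Bx <-] xy] :=
    (closure_nrmP E _ _).1 Dy0 (e / (1 + d)) (divr_gt0 ep d10).
  exists (S x); first by exists x.
  rewrite SE /z0 -LB; apply: le_lt_trans (L_lip _) _.
  by rewrite mulrC -ltr_pdivlMr.
(* [z0] has norm [c] and lies in the closure of the image of the ball, so no smaller bound is
   possible. *)
have opS : opnorm S = emb c.
  apply: opnormE => [x Bx|k kS]; first by rewrite -(emb_nrm E) emb_le S_le.
  have k0 : 0 <= k.
    by apply: le_trans (kS 0 _); rewrite ?normr0 // linear0 normr0.
  rewrite -(embK E k0) emb_le; apply/ler_addgt0Pl => e ep.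
  have [_ [x Bx <-] xz] := (closure_nrmP E _ _).1 Dz0 e ep.
  have : nrm (S x) <= re k by rewrite -(emb_le E) emb_nrm (embK E k0) kS.
  rewrite -z0c; have := nrm_add E (z0 - S x) (S x); rewrite subrK.
  by move: xz; rewrite {1}/nrm distrC -/(nrm _); lra.
have z0S : `|z0| = opnorm S by rewrite opS -z0c emb_nrm.
exists S; split.
- split; last by exists z0.
  exists (emb c); split; first by rewrite ger0_real // emb_ge0 -z0c.
  move=> k ck x Bx /=; apply: le_trans (ltW ck).
  by rewrite -(emb_nrm E) emb_le S_le.
- apply: (@le_lt_trans _ _ (emb (d * M))); last by rewrite emb_lt.
  apply: opnorm_le => [|x Bx]; first by rewrite emb_ge0 mulr_ge0 // ltW.
  rewrite -(emb_nrm E) emb_le /= /L addrAC subrr add0r.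
  apply: le_trans (psiu _) _; apply: le_trans (psid _) _.
  by rewrite ler_wpM2l ?TM // ltW.
exists z0; split => // x xB Sx.
have /choice[theta thetaP] n : exists t : K, `|t| = 1 /\
    t * psi (T (x n)) = `|psi (T (x n))|.
  by have [t t1 tpsi] := phase (psi (T (x n))); exists t.
have theta1 n : `|theta n| = 1 by case: (thetaP n).
have thetaS : S (theta n *: x n) @[n --> \oo] --> z0.
  apply/(cvg_nrmP E) => e ep.
  (* [L] is Lipschitz with constant [1 + d]; the factor 2 turns the weak inequality of [ystrong]
     into a strict one. *)
  have d10 : 0 < 2 * (1 + d) by lra.
  have [h h0 hP] := ystrong _ (divr_gt0 ep d10).
  have [n0 n0P] := (cvg_nrmP E _ _).1 Sx h h0; exists n0 => n nn0.
  have near : nrm (T (theta n *: x n) - y0) <= e / (2 * (1 + d)).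
    rewrite linearZ; apply: hP.
    - by apply: closed_ball_image_phase => //; exact: DT (xB n).
    - by rewrite scalarZ (thetaP n).2.
    have nrmt (W : normedModType K) (y : W) : nrm (theta n *: y) = nrm y.
      by rewrite /nrm normrZ theta1 mul1r.
    have -> : psi (theta n *: T (x n)) = theta n * psi (T (x n)) by rewrite scalarZ.
    rewrite nrmt (_ : nrm (_ * _) = nrm (psi (T (x n)))); last first.
      by rewrite /nrm normrM theta1 mul1r.
    (* [S (x n)] has norm above [c - h], and by [L_le] so has the sum of the norms of [T (x n)] and
       [psi (T (x n))]. *)
    have := n0P n nn0; rewrite opS -(emb_nrm E (S (x n))) -rmorphB nrm_emb.
    rewrite ltr_norml => /andP[lt _].
    by have := L_le (T (x n)); rewrite -SE -/c; lra.
  rewrite SE /z0 -LB; apply: le_lt_trans (L_lip _) _.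
  have h1 : (1 + d) * nrm (T (theta n *: x n) - y0) <= (1 + d) * (e / (2 * (1 + d))).
    by rewrite ler_pM2l //; lra.
  have h2 : (1 + d) * (e / (2 * (1 + d))) = e / 2 by field; lra.
  by lra.
split; first by exists theta.
have [sigma [t [sinc st]]] := unit_subseq E theta1.
have t1 : `|t| = 1.
  apply/eqP; rewrite -subr_eq0; apply/eqP/(nrm_eq0 (E := E))/eqP.
  rewrite eq_le nrm0 andbT; apply/ler_addgt0Pl => e ep; rewrite addr0.
  have [n nP] := st e ep; apply: le_trans (ltW (nP n (leqnn n))).
  by rewrite -(emb_le E) emb_nrm embK // -(theta1 (sigma n)) distrC ler_dist_dist.
have t_neq0 : t != 0 by rewrite -normr_eq0 t1 oner_eq0.
exists t^-1, sigma; split => //; first by rewrite normfV t1 invr1.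
apply/(cvg_nrmP E) => e ep.
have c0 : 0 <= c by rewrite -z0c.
have c10 : 0 < 2 * (c + 1) by lra.
have [n0 n0P] := st _ (divr_gt0 ep c10).
have e20 : 0 < e / 2 by lra.
have [n1 n1P] := (cvg_nrmP E _ _).1 thetaS _ e20.
exists (maxn n0 n1) => n; rewrite geq_max => /andP[nn0 nn1].
have h1 := n1P _ (leq_trans nn1 (increasing_seq_ge n sinc)).
have h2 : nrm ((t - theta (sigma n)) *: S (x (sigma n))) <= e / (2 * (c + 1)) * c.
  rewrite nrm_scale ler_pM // ?S_le //; last exact: xB.
  by have := n0P n nn0; rewrite distrC => /ltW.
have h3 : e / (2 * (c + 1)) * c <= e / 2.
  have -> : e / (2 * (c + 1)) * c = (e / 2) * (c / (c + 1)) by field; lra.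
  by rewrite ler_piMr ?(ltW e20) // ler_pdivrMr; lra.
have -> : nrm (S (x (sigma n)) - t^-1 *: z0) = nrm (t *: S (x (sigma n)) - z0).
  have -> : t *: S (x (sigma n)) - z0 = t *: (S (x (sigma n)) - t^-1 *: z0).
    by rewrite scalerBr scalerA mulfV // scale1r.
  by rewrite nrm_scale (_ : nrm t = 1) ?mul1r // /nrm t1 -(rmorph1 emb) re_emb.
(* The first term is small since the phases converge and [S] is bounded by [c] on the ball, the
   second by [thetaS]. *)
have -> : t *: S (x (sigma n)) - z0 = (t - theta (sigma n)) *: S (x (sigma n)) +
    (S (theta (sigma n) *: x (sigma n)) - z0).
  by rewrite linearZ scalerBl addrA subrK.
by have := nrm_add E ((t - theta (sigma n)) *: S (x (sigma n)))
  (S (theta (sigma n) *: x (sigma n)) - z0); lra.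
Qed.

End StrongRadonNikodym.

Theorem theorem3p1 (R : realType) (K : numFieldType)
    (hK : real_or_complex R K) (X Y : completeNormedModType K)
    (eps : K) (eps_gt0 : 0 < eps)
    (T : {linear X -> Y}) (T_bounded : bounded_operator T)
    (T_RN : strong_Radon_Nikodym T) :
  exists S : {linear X -> Y},
    [/\ QNA S,
        opnorm (S \- T) < eps &
        exists z0 : Y,
          [/\ closed_ball_image S z0,
              `|z0| = opnorm S &
              forall x : nat -> X,
                (forall n, closed_unit_ball X (x n)) ->
                `|S (x n)| @[n --> \oo] --> opnorm S ->
                (exists theta : nat -> K,
                  (forall n, `|theta n| = 1) /\
                  S (theta n *: x n) @[n --> \oo] --> z0) /\
                (exists (theta0 : K) (sigma : nat -> nat),
                  [/\ `|theta0| = 1,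
                      increasing_seq sigma &
                      S (x (sigma n)) @[n --> \oo] --> theta0 *: z0])]].
Proof.
(* A disjunction of propositions cannot be eliminated into data, hence [inhabited]. *)
have [E] : inhabited (realification R K).
  case: hK => ->; constructor; first exact: realification_real.
  exact: realification_complex.
exact: (strong_Radon_Nikodym_perturbation E eps_gt0 T_bounded T_RN).
Qed.
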